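(* Let $G = \langle a \rangle$ be an infinite cyclic group generated by $\{a\}$. Then the conjugation quandle $\mathrm{Conj}(G)$ is non-Hopfian (as a quandle), whereas $G$ is Hopfian (as a group).
   Context: A quandle is a non-empty set $Q$ with a binary operation $* : Q \times Q \to Q$ such that: (i) $x * x = x$ for all $x \in Q$; (ii) for all $x, y \in Q$ there exists a unique $z \in Q$ such that $x = z * y$; (iii) $(x * y) * z = (x * z) * (y * z)$ for all $x, y, z \in Q$. A quandle homomorphism is a map $f$ between quandles with $f(x*y) = f(x)*f(y)$ for all $x,y$. For a group $G$, the conjugation quandle $\mathrm{Conj}(G)$ is the set $G$ with the operation $x * y = y^{-1}xy$. An algebraic structure (group or quandle) is called Hopfian if every surjective endomorphism of it (a surjective group, respectively quandle, homomorphism from it to itself) is an automorphism; it is non-Hopfian if it is not Hopfian. *)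

(* Defs.v *)
From HB Require Import structures.
From mathcomp Require Import all_boot.
From mathcomp Require Import boolp classical_sets functions cardinality.

Set Implicit Arguments.
Unset Strict Implicit.
Unset Printing Implicit Defensive.

Local Open Scope classical_set_scope.
Local Open Scope group_scope.

HB.mixin Record isQuandle (Q : Type) := {
  quandle_op : Q -> Q -> Q;
  quandle_inhabited : inhabited Q;
  quandle_idem : forall x, quandle_op x x = x;
  quandle_div : forall x y, exists! z, x = quandle_op z y;
  quandle_distr : forall x y z,
    quandle_op (quandle_op x y) z
    = quandle_op (quandle_op x z) (quandle_op y z)
}.

#[short(type="quandleType")]
HB.structure Definition Quandle := {Q of isQuandle Q}.

Definition quandle_morphism (Q R : quandleType) (f : Q -> R) : Prop :=
  forall x y, f (quandle_op x y) = quandle_op (f x) (f y).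

(* An alias of G, so that its quandle structure is found by inference. *)
Definition Conj (G : groupType) : Type := G.

Section ConjQuandle.
Variable G : groupType.

Definition conj_op (x y : Conj G) : Conj G := (y : G)^-1 * (x : G) * (y : G).

Lemma conj_opE (x y : G) : conj_op x y = x ^ y.
Proof. by rewrite /conj_op conjgE mulgA. Qed.

Lemma conj_inhabited : inhabited (Conj G).
Proof. exact: (inhabits (1 : G)). Qed.

Lemma conj_op_idem (x : Conj G) : conj_op x x = x.
Proof. by rewrite conj_opE conjgE mulKg. Qed.

Lemma conj_op_div (x y : Conj G) : exists! z, x = conj_op z y.
Proof.
exists ((x : G) ^ (y : G)^-1); split=> [|z ->].
  by rewrite conj_opE conjgKV.
by rewrite conj_opE conjgK.
Qed.

Lemma conj_op_distr (x y z : Conj G) :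
  conj_op (conj_op x y) z = conj_op (conj_op x z) (conj_op y z).
Proof. by rewrite !conj_opE conjJg. Qed.

HB.instance Definition _ := isQuandle.Build (Conj G)
  conj_inhabited conj_op_idem conj_op_div conj_op_distr.

End ConjQuandle.

(* An automorphism is a bijective endomorphism. *)
Definition quandle_hopfian (Q : quandleType) : Prop :=
  forall f : Q -> Q, quandle_morphism f -> set_surj setT setT f -> bijective f.

Definition group_hopfian (G : groupType) : Prop :=
  forall f : {multiplicative G -> G}, set_surj setT setT f -> bijective f.

Definition subgroup (G : groupType) (H : set G) : Prop :=
  [/\ H 1,
      forall x y, H x -> H y -> H (x * y) &
      forall x, H x -> H x^-1].

Definition generated_subgroup (G : groupType) (A : set G) : set G :=
  smallest (@subgroup G) A.

Definition infinite_cyclic_on (G : groupType) (a : G) : Prop :=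
  generated_subgroup [set a] = [set: G] /\ infinite_set [set: G].

(* Main.v *)
Require Import Defs.
From HB Require Import structures.
From mathcomp Require Import all_boot.
From mathcomp Require Import boolp classical_sets functions cardinality.

(** Two independent facts are at work.

    A cyclic group is commutative, so conjugation in it is trivial:
    [x ^ y = x]. Every self-map of [Conj G] is then a quandle endomorphism,
    and an infinite set carries a surjective self-map that is not injective:
    shift a copy of the natural numbers down by one, sending both of its first
    two elements to the first one, and fix everything else
    ([infinite_set_noninjective_surj]).

    Every element of [G = <a>] is a quotient [a ^+ m / a ^+ n]. If [f] is a
    surjective endomorphism of [G], its image [G] consists of the quotients of
    powers of [b = f a]. An element [a ^+ m / a ^+ n] of the kernel other than
    [1] has [m <> n] and gives [b ^+ m = b ^+ n], so [b] has finite order and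
    [G] is finite ([finite_set_expg_quotients]), a contradiction. Hence [f] is
    injective. *)

Set Implicit Arguments.
Unset Strict Implicit.
Unset Printing Implicit Defensive.

Local Open Scope classical_set_scope.
Local Open Scope group_scope.

Lemma infinite_set_noninjective_surj (T : Type) :
  infinite_set [set: T] ->
  exists2 f : T -> T, set_surj setT setT f & ~ injective f.
Proof.
(* [s] is a section of a surjection [h] onto the natural numbers; the image of
   [s] is the set of fixed points of [s \o h]. *)
move=> /infiniteP/pcard_geP[h].
have /choice[s hs] n : exists x, h x = n.
  by have [x _ <-] := @surj _ _ _ _ h n I; exists x.
exists (fun x => if `[< x = s (h x) >] then s (h x).-1 else x).
  move=> y _; have [yE|yN] := pselect (y = s (h y)).
    exists (s (h y).+1) => //=; rewrite hs /=.
    by case: asboolP => // _; rewrite -yE.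
  by exists y => //=; case: asboolP.
move=> /(_ (s 0%N) (s 1%N)); rewrite !hs /=.
case: asboolP => // _; case: asboolP => // _ /(_ erefl) /(congr1 h).
by rewrite !hs.
Qed.

Lemma quandle_morphism_Conj_abelian (G : groupType) (f : Conj G -> Conj G) :
  (forall x y : G, commute x y) -> quandle_morphism f.
Proof.
move=> GC.
have opE (x y : Conj G) : quandle_op x y = x.
  by rewrite /quandle_op /= /conj_op -mulgA (GC x y) mulKg.
by move=> x y; rewrite !opE.
Qed.

Lemma generated_subgroup1P (G : groupType) (a x : G) :
  generated_subgroup [set a] x -> exists m n, x = a ^+ m / a ^+ n.
Proof.
move: x; apply: smallest_sub => [|_ ->]; last first.
  by exists 1%N, 0%N; rewrite expg0 divg1 expg1.
have aC i j : commute (a ^+ i) (a ^+ j)^-1.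
  by apply/commuteV/commuteX2.
split=> [|_ _ [m [n ->]] [p [q ->]]|_ [m [n ->]]].
- by exists 0%N, 0%N; rewrite divgg.
- exists (m + p), (q + n); rewrite !expgnDr invgM !mulgA; congr (_ * _).
  by rewrite -!mulgA; congr (_ * _); exact/esym/aC.
- by exists n, m; rewrite invgF.
Qed.

Lemma commute_expg_quotients (G : groupType) (a : G) (m n p q : nat) :
  commute (a ^+ m / a ^+ n) (a ^+ p / a ^+ q).
Proof.
have aQ k : commute a (a ^+ k / a ^+ q).
  by apply: commuteM; [exact: commuteX | exact/commuteV/commuteX].
apply/commute_sym/commuteM; first exact/commuteX/commute_sym.
exact/commuteV/commuteX/commute_sym.
Qed.

Lemma finite_set_expg_quotients (G : groupType) (b : G) (m n : nat) :
  m <> n -> b ^+ m = b ^+ n ->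
  finite_set [set x | exists i j, x = b ^+ i / b ^+ j].
Proof.
wlog lt_mn : m n / m < n.
  move=> W /eqP mn bmn; move: (mn); rewrite neq_ltn => /orP[] /W; apply=> //.
    exact/eqP.
  by apply/eqP; rewrite eq_sym.
move=> _ bmn; set p := n - m.
have p_gt0 : 0 < p by rewrite subn_gt0.
have bp : b ^+ p = 1 by rewrite expgnFr ?(ltnW lt_mn)// bmn divgg.
have bmod k : b ^+ k = b ^+ (k %% p).
  by rewrite {1}(divn_eq k p) expgnDr mulnC expgnA bp expg1n mul1g.
apply: sub_finite_set (finite_image (fun k => b ^+ k) (finite_II p)).
(* As [b ^+ p = 1], the inverse of [b ^+ j] is [b ^+ (p - j %% p)]. *)
move=> _ [i [j ->]]; exists ((i + (p - j %% p)) %% p).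
  by rewrite /= ltn_mod.
rewrite -bmod expgnDr expgnFr ?bp; last by rewrite ltnW// ltn_mod.
by rewrite -bmod div1g.
Qed.

Theorem theorem3p2 (G : groupType) (a : G) (Ga : infinite_cyclic_on a) :
  ~ quandle_hopfian (Conj G) /\ group_hopfian G.
Proof.
case: Ga => genG infG.
have GP (x : G) : exists m n, x = a ^+ m / a ^+ n.
  by apply: generated_subgroup1P; rewrite genG.
split=> [hopf|f fsurj].
  have [f fsurj] := infinite_set_noninjective_surj infG; apply.
  apply/bij_inj/(hopf f _ fsurj)/quandle_morphism_Conj_abelian => x y.
  have [[m [n ->]] [p [q ->]]] := (GP x, GP y).
  exact: commute_expg_quotients.
(* A multiplicative map between groups preserves [1]; packing this as [F] gives
   access to the theory of morphisms of groups. *)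
have f1 : f 1 = 1 by apply: (mulgI (f 1)); rewrite -gmulfM !mulg1.
pose F : UMagmaMorphism.type G G :=
  HB.pack (f : G -> G) (isMultiplicative.Build G G f (@gmulfM _ _ f))
    (Multiplicative_isUMagmaMorphism.Build G G f f1).
have fQ i j : f (a ^+ i / a ^+ j) = f a ^+ i / f a ^+ j.
  by rewrite (gmulfF F) !(gmulfXn F).
suff finj : injective f.
  rewrite -setTT_bijective; split=> // x y _ _; exact: finj.
apply: (@gmulf_inj _ _ F) => x; have [m [n ->]] := GP x.
rewrite [F _]fQ => /divg1_eq bmn.
have [->|/eqP mn] := eqVneq m n; first by rewrite divgg.
exfalso; apply/infG/(sub_finite_set _ (finite_set_expg_quotients mn bmn)).
move=> _ /fsurj[z _ <-]; have [i [j ->]] := GP z.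
by exists i, j; rewrite fQ.
Qed.
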